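(* Let $F\in K[x]$ be a monic irreducible polynomial, and let $\nu\in\mathcal V_F\setminus\{\nu_0\}$ be a valuation that is not a maximal element of $(\mathcal V,\leq)$. Write $$\mathrm{in}_\nu(F)=u\cdot\prod_{i=1}^n\phi_i^{r_i},$$ where $u\in\mathcal U_\nu$, each $r_i$ is a positive integer, each $\phi_i\in\mathcal G_\nu$ is homogeneous and irreducible, and $\phi_i\nmid\phi_j$ if $i\neq j$. Then there exist distinct valuations $\mu_1,\ldots,\mu_n\in\mathcal V_{F_\infty}$ such that $\nu<\mu_i$ for every $i$, $1\leq i\leq n$.
   Context: $(K,\nu_0)$ is a valued field with value group $\Gamma_0$, and $\Gamma$ is a fixed totally ordered divisible abelian group containing $\Gamma_0$; $\Gamma_\infty=\Gamma\cup\{\infty\}$ with the usual conventions. A valuation on a commutative unital ring $R$ is a map $\nu:R\to\Gamma_\infty$ with $\nu(ab)=\nu(a)+\nu(b)$, $\nu(a+b)\geq\min\{\nu(a),\nu(b)\}$, $\nu(1)=0$, $\nu(0)=\infty$; nonzero elements may have value $\infty$. Its support is $\mathrm{supp}(\nu)=\{a\in R\mid\nu(a)=\infty\}$. $\mathcal V=\{\nu_0\}\cup\{\nu:K[x]\to\Gamma_\infty\mid \nu\text{ is a valuation extending }\nu_0\}$, partially ordered by: $\nu_0\leq\nu$ for all $\nu\in\mathcal V$, and for $\nu,\mu\in\mathcal V\setminus\{\nu_0\}$, $\nu\leq\mu$ iff $\nu(f)\leq\mu(f)$ for every $f\in K[x]$. For a monic irreducible $F\in K[x]$: $\mathcal V_{F_\infty}=\{\mu\in\mathcal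 V\mid\mathrm{supp}(\mu)=(F)\}$ and $\mathcal V_F=\{\nu\in\mathcal V\mid\nu\leq\mu\text{ for some }\mu\in\mathcal V_{F_\infty}\}$. For $\nu\in\mathcal V\setminus\{\nu_0\}$, the graded ring is $\mathcal G_\nu=\bigoplus_{\gamma\in\nu(K[x]),\,\gamma<\infty}\mathcal P_\gamma/\mathcal P_\gamma^+$, where $\mathcal P_\gamma=\{a\in K[x]\mid\nu(a)\geq\gamma\}$ and $\mathcal P_\gamma^+=\{a\in K[x]\mid\nu(a)>\gamma\}$, with multiplication induced by that of $K[x]$ (it is an integral domain). $\mathcal U_\nu$ is the set of units of $\mathcal G_\nu$. For $a\notin\mathrm{supp}(\nu)$, $\mathrm{in}_\nu(a)$ is the image of $a$ in $\mathcal P_{\nu(a)}/\mathcal P_{\nu(a)}^+\subseteq\mathcal G_\nu$; for $a\in\mathrm{supp}(\nu)$, $\mathrm{in}_\nu(a)=0$. *)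

(* Defs.v *)
From HB Require Import structures.
From mathcomp Require Import all_boot all_order all_algebra.
From mathcomp Require Import boolp classical_sets fsbigop.
Set Implicit Arguments.
Unset Strict Implicit.
Unset Printing Implicit Defensive.
Import Order.TTheory GRing.Theory.
Import Quotient.

Local Open Scope ring_scope.
Local Open Scope quotient_scope.

(* Totality is a field because the library declares no join of its lattice
   structures with [zmodType] that would allow inheriting [orderType] here. *)

HB.mixin Record isOrderedGroup G of Num.POrderedZmodule G := {
  ogroup_total : total (<=%R : rel G);
  ogroup_leD2l : forall x y z : G, y <= z -> x + y <= x + z
}.

#[short(type="oGroupType")]
HB.structure Definition OrderedGroup :=
  { G of isOrderedGroup G & Num.POrderedZmodule G }.

Definition divisible_group (G : zmodType) : Prop :=
  forall (n : nat) (x : G), (0 < n)%N -> exists y : G, y *+ n = x.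

(* [None] is infinity, the largest element. *)
Definition with_infty (G : Type) : Type := option G.

Definition fin (G : Type) (g : G) : with_infty G := Some g.
Definition infty {G : Type} : with_infty G := None.

Section WithInfty.
Variable G : oGroupType.
Implicit Types x y z : with_infty G.

HB.instance Definition _ := Choice.copy (with_infty G) (option G).

Definition le_infty x y : bool :=
  match x, y with
  | _, None => true
  | None, Some _ => false
  | Some g, Some h => g <= h
  end.

Definition add_infty x y : with_infty G :=
  match x, y with
  | Some g, Some h => fin (g + h)
  | _, _ => infty
  end.

Lemma le_infty_refl : reflexive le_infty.
Proof. by case=> //= g. Qed.

Lemma le_infty_anti : antisymmetric le_infty.
Proof. by move=> [g|] [h|] //= /le_anti ->. Qed.

Lemma le_infty_trans : transitive le_infty.
Proof. by move=> [g|] [h|] [k|] //=; apply: le_trans. Qed.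

Lemma le_infty_total : total le_infty.
Proof. by move=> [g|] [h|] //=; apply: ogroup_total. Qed.

HB.instance Definition _ := Order.Le_isPOrder.Build ring_display (with_infty G)
  le_infty_refl le_infty_anti le_infty_trans.
HB.instance Definition _ :=
  Order.POrder_isTotal.Build ring_display (with_infty G) le_infty_total.

Lemma add_inftyA : associative add_infty.
Proof. by move=> [g|] [h|] [k|] //=; rewrite addrA. Qed.

Lemma add_inftyC : commutative add_infty.
Proof. by move=> [g|] [h|] //=; rewrite addrC. Qed.

Lemma add0_infty : left_id (fin 0) add_infty.
Proof. by move=> [g|] //=; rewrite add0r. Qed.

HB.instance Definition _ :=
  GRing.isNmodule.Build (with_infty G) add_inftyA add_inftyC add0_infty.

Lemma fin_le (g h : G) : (fin g <= fin h) = (g <= h).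
Proof. by []. Qed.

Lemma fin_lt (g h : G) : (fin g < fin h) = (g < h).
Proof. by rewrite !lt_def fin_le (inj_eq Some_inj). Qed.

Lemma finD (g h : G) : fin (g + h) = fin g + fin h.
Proof. by []. Qed.

Lemma lex_infty x : x <= infty.
Proof. by case: x. Qed.

Lemma leD_infty x y z t : x <= y -> z <= t -> x + z <= y + t.
Proof.
have leD2l (u v w : with_infty G) : v <= w -> u + v <= u + w.
  case: u v w => [u|] [v|] [w|] //; exact: ogroup_leD2l.
move=> xy zt; apply: le_trans (leD2l y _ _ zt).
by rewrite ![_ + z]addrC leD2l.
Qed.

Lemma ltD_infty (g h : G) x y : fin g < x -> fin h <= y -> fin (g + h) < x + y.
Proof.
case: x y => [x|] [y|] //; rewrite -[Some x]/(fin x) -[Some y]/(fin y).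
rewrite -finD !fin_lt fin_le => gx hy.
have := ogroup_leD2l _ _ _ hy => /(_ x); apply: lt_le_trans.
rewrite lt_def ![_ + h]addrC ogroup_leD2l 1?ltW // andbT.
by rewrite (inj_eq (addrI h)) gt_eqF.
Qed.

End WithInfty.

Record valuation (R : comNzRingType) (G : oGroupType) := Valuation {
  val_fun :> R -> with_infty G;
  valM : forall a b, val_fun (a * b) = val_fun a + val_fun b;
  valD : forall a b, Order.min (val_fun a) (val_fun b) <= val_fun (a + b);
  val1 : val_fun 1 = 0;
  val0 : val_fun 0 = infty
}.

Lemma valuation_ext (R : comNzRingType) (G : oGroupType)
  (nu mu : valuation R G) : (forall a, nu a = mu a) -> nu = mu.
Proof.
case: nu mu => [f fM fD f1 f0] [g gM gD g1 g0] /= /funext fg.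
rewrite -{}fg in gM gD g1 g0 *.
by congr Valuation; apply: Prop_irrelevance.
Qed.

Definition in_supp (R : comNzRingType) (G : oGroupType) (nu : valuation R G)
  (a : R) : Prop := nu a = infty.

Section GradedRing.
Variables (R : comNzRingType) (G : oGroupType) (nu : valuation R G).
Implicit Types (a b : R) (g h k : G).

Lemma valDge x a b : x <= nu a -> x <= nu b -> x <= nu (a + b).
Proof. by move=> xa xb; apply: le_trans (valD _ _ _); rewrite le_min xa. Qed.

Lemma valDgt x a b : x < nu a -> x < nu b -> x < nu (a + b).
Proof. by move=> xa xb; apply: lt_le_trans (valD _ _ _); rewrite lt_min xa. Qed.

Lemma valN1 : nu (-1) = 0.
Proof.
have /esym := valM nu (-1) (-1); rewrite mulrNN mulr1 val1.
case: (nu (-1)) => [g|] // [] gg0; congr Some; apply/le_anti/andP.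
have gP : g <= 0 <-> 0 <= g.
  by split=> /(ogroup_leD2l g); rewrite gg0 addr0.
by case/orP: (ogroup_total g 0) => ?; split=> //; apply/gP.
Qed.

Lemma valN a : nu (- a) = nu a.
Proof. by rewrite -mulN1r valM valN1 add0r. Qed.

Definition Pge_pred g : {pred R} := fun a => fin g <= nu a.

Lemma Pge_zmod_closed g : zmod_closed (Pge_pred g).
Proof.
split=> [|a b]; rewrite !unfold_in ?val0 ?lex_infty // => ga gb.
by rewrite valDge // valN.
Qed.
HB.instance Definition _ g :=
  GRing.isZmodClosed.Build R (Pge_pred g) (Pge_zmod_closed g).

Record Pge g := MkPge { Pge_val : R; Pge_valP : Pge_pred g Pge_val }.

HB.instance Definition _ g := [isSub for @Pge_val g].
HB.instance Definition _ g := [Choice of Pge g by <:].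
HB.instance Definition _ g := [SubChoice_isSubZmodule of Pge g by <:].

Definition Pgt_pred g : {pred Pge g} := fun x => fin g < nu (val x).
Arguments Pgt_pred : clear implicits.

Lemma Pgt_zmod_closed g : zmod_closed (Pgt_pred g).
Proof.
split=> [|a b]; rewrite !unfold_in ?raddf0 ?val0 // => ga gb.
by rewrite raddfB valDgt // valN.
Qed.
HB.instance Definition _ g :=
  GRing.isZmodClosed.Build (Pge g) (Pgt_pred g) (Pgt_zmod_closed g).

Definition gr_piece g : Type := {quot (Pgt_pred g : zmodClosed (Pge g))}.
HB.instance Definition _ g := ZmodQuotient.on (gr_piece g).

(* The class of [a] in the piece of degree [g]; only meaningful for
    [nu a >= g] (it is [0] otherwise). *)
Definition piece_class g a : gr_piece g :=
  \pi_(gr_piece g) (insubd (0 : Pge g) a).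

Definition piece_repr g (x : gr_piece g) : R := val (repr x).

(* The product of [x] and [y] in the piece of degree [k]; only meaningful for
    [k = g + h].  Leaving [k] free avoids transporting along equalities of
    degrees. *)
Definition piece_mul g h k (x : gr_piece g) (y : gr_piece h) : gr_piece k :=
  piece_class k (piece_repr x * piece_repr y).

Definition fin_supp (f : forall g, gr_piece g) : Prop :=
  exists s : seq G, forall g, g \notin s -> f g = 0.

(* The direct sum is indexed by the whole group [G]: the
    piece of degree [g] is zero when [g] is not a value of [nu], see
    [gr_piece_triv]. *)
Record gr_ring := GrRing {
  gr_coord :> forall g, gr_piece g;
  gr_coordP : fin_supp gr_coord
}.

HB.instance Definition _ := gen_eqMixin gr_ring.
HB.instance Definition _ := gen_choiceMixin gr_ring.

Lemma gr_ext (x y : gr_ring) : (forall g, x g = y g) -> x = y.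
Proof.
case: x y => [x xP] [y yP] /= xy.
have E : x = y by apply: functional_extensionality_dep.
by rewrite -{}E in yP *; congr GrRing; apply: Prop_irrelevance.
Qed.

Lemma fin_supp0 : fin_supp (fun g => 0).
Proof. by exists [::]. Qed.

Lemma fin_suppN (x : gr_ring) : fin_supp (fun g => - x g).
Proof. by case: (gr_coordP x) => s sP; exists s => g /sP ->; rewrite oppr0. Qed.

Lemma fin_suppD (x y : gr_ring) : fin_supp (fun g => x g + y g).
Proof.
case: (gr_coordP x) (gr_coordP y) => [s sP] [t tP].
exists (s ++ t) => g; rewrite mem_cat => /norP[/sP -> /tP ->].
by rewrite addr0.
Qed.

Definition gr_zero := GrRing fin_supp0.
Definition gr_opp x := GrRing (fin_suppN x).
Definition gr_add x y := GrRing (fin_suppD x y).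

Lemma gr_addA : associative gr_add.
Proof. by move=> x y z; apply: gr_ext => g; rewrite /= addrA. Qed.
Lemma gr_addC : commutative gr_add.
Proof. by move=> x y; apply: gr_ext => g; rewrite /= addrC. Qed.
Lemma gr_add0 : left_id gr_zero gr_add.
Proof. by move=> x; apply: gr_ext => g; rewrite /= add0r. Qed.
Lemma gr_addN : left_inverse gr_zero gr_opp gr_add.
Proof. by move=> x; apply: gr_ext => g; rewrite /= addNr. Qed.

HB.instance Definition _ :=
  GRing.isZmodule.Build gr_ring gr_addA gr_addC gr_add0 gr_addN.

Lemma gr0E g : (0 : gr_ring) g = 0.
Proof. by []. Qed.
Lemma grDE (x y : gr_ring) g : (x + y) g = x g + y g.
Proof. by []. Qed.

Lemma piece_class_eq g a b : fin g <= nu a -> fin g <= nu b ->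
  reflect (piece_class g a = piece_class g b) (fin g < nu (a - b)).
Proof.
move=> ga gb; have -> : fin g < nu (a - b) =
    Pgt_pred g (insubd (0 : Pge g) a - insubd (0 : Pge g) b).
  by rewrite /Pgt_pred raddfB /= !insubdK.
rewrite -[Pgt_pred _ _]/(_ \in (Pgt_pred g : zmodClosed (Pge g))).
by rewrite idealrBE; apply: eqP.
Qed.

Lemma piece_reprP g (x : gr_piece g) : fin g <= nu (piece_repr x).
Proof. exact: (valP (repr x)). Qed.

Lemma piece_reprK g (x : gr_piece g) : piece_class g (piece_repr x) = x.
Proof. by rewrite /piece_class valKd reprK. Qed.

Lemma piece_classD g a b : fin g <= nu a -> fin g <= nu b ->
  piece_class g (a + b) = piece_class g a + piece_class g b.
Proof.
move=> ga gb; rewrite /piece_class -raddfD; congr (\pi _); apply: val_inj.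
by rewrite raddfD /= !insubdK //; apply: valDge.
Qed.

Lemma piece_class0 g : piece_class g 0 = 0.
Proof.
rewrite /piece_class -[RHS](raddf0 \pi_(gr_piece g)); congr (\pi _).
by apply: val_inj; rewrite insubdK // unfold_in val0 lex_infty.
Qed.

Lemma gr_piece_triv g (x : gr_piece g) :
  (forall a, nu a <> fin g) -> x = 0.
Proof.
move=> gP; rewrite -(piece_reprK x) -(piece_class0 g).
apply/piece_class_eq; rewrite ?piece_reprP ?val0 ?lex_infty // subr0.
by rewrite lt_def piece_reprP andbT; apply/eqP/gP.
Qed.

Lemma piece_mul_class g h a b : fin g <= nu a -> fin h <= nu b ->
  piece_mul (g + h) (piece_class g a) (piece_class h b) =
  piece_class (g + h) (a * b).
Proof.
move=> ga hb; rewrite /piece_mul.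
set c := piece_repr _; set d := piece_repr _.
have gc : fin g <= nu c by apply: piece_reprP.
have hd : fin h <= nu d by apply: piece_reprP.
have /piece_class_eq-/(_ gc ga) ca : piece_class g c = piece_class g a.
  exact: piece_reprK.
have /piece_class_eq-/(_ hd hb) db : piece_class h d = piece_class h b.
  exact: piece_reprK.
apply/piece_class_eq; rewrite ?valM ?finD ?leD_infty //.
have -> : c * d - a * b = (c - a) * d + a * (d - b).
  by rewrite mulrBl mulrBr addrA addrNK.
apply: valDgt; rewrite valM; first exact: ltD_infty.
by rewrite -finD [g + h]addrC [nu a + _]addrC ltD_infty.
Qed.

Lemma piece_mulDl g h (x x' : gr_piece g) (y : gr_piece h) :
  piece_mul (g + h) (x + x') y = piece_mul (g + h) x y + piece_mul (g + h) x' y.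
Proof.
rewrite -[x]piece_reprK -[x']piece_reprK -[y]piece_reprK.
rewrite -piece_classD ?piece_reprP // !piece_mul_class ?valDge ?piece_reprP //.
by rewrite mulrDl piece_classD // valM finD leD_infty ?piece_reprP.
Qed.

Lemma piece_mulC g h k (x : gr_piece g) (y : gr_piece h) :
  piece_mul k x y = piece_mul k y x.
Proof. by rewrite /piece_mul mulrC. Qed.

Lemma piece_mul0l g h (y : gr_piece h) : piece_mul (g + h) (0 : gr_piece g) y = 0.
Proof.
by apply: (addrI (piece_mul (g + h) (0 : gr_piece g) y)); rewrite -piece_mulDl !addr0.
Qed.

Definition gr_mul_fun (x y : gr_ring) (k : G) : gr_piece k :=
  \sum_(p \in [set p : G * G | p.1 + p.2 = k]%classic) piece_mul k (x p.1) (y p.2).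

Lemma gr_mul_funE (r s : seq G) (x y : gr_ring) k :
  uniq r -> uniq s ->
  (forall g, g \notin r -> x g = 0) -> (forall g, g \notin s -> y g = 0) ->
  gr_mul_fun x y k =
  \sum_(g <- r) \sum_(h <- s | g + h == k) piece_mul k (x g) (y h).
Proof.
move=> ur us rP sP; rewrite /gr_mul_fun.
pose P : {pred G * G} := fun p => p.1 + p.2 == k.
have -> : [set p : G * G | p.1 + p.2 = k]%classic = [set` P]%classic.
  by apply/seteqP; split=> p /eqP.
rewrite -(@bigfs _ _ _ _ [seq (g, h) | g <- r, h <- s]).
- rewrite big_mkcond big_allpairs; apply: eq_bigr => g _.
  by rewrite [RHS]big_mkcond; apply: eq_bigr.
- by apply: allpairs_uniq => // -[? ?] [? ?].
move=> [g h] /eqP /= ghk; apply: contraNeq => nz.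
apply/allpairsP; exists (g, h); split=> //=.
  apply: contraNT nz => /rP ->; rewrite -ghk; apply/eqP/piece_mul0l.
apply: contraNT nz => /sP ->; rewrite piece_mulC -ghk addrC.
exact/eqP/piece_mul0l.
Qed.

Lemma gr_suppE (x : gr_ring) :
  exists2 r : seq G, uniq r & forall g, g \notin r -> x g = 0.
Proof.
case: (gr_coordP x) => s sP; exists (undup s); first exact: undup_uniq.
by move=> g; rewrite mem_undup => /sP.
Qed.

Lemma fin_supp_mul x y : fin_supp (gr_mul_fun x y).
Proof.
have [[r ur rP] [s us sP]] := (gr_suppE x, gr_suppE y).
exists [seq g + h | g <- r, h <- s] => k kP.
rewrite (gr_mul_funE _ ur us rP sP) big_seq big1 // => g gr.
rewrite big_seq_cond big1 // => h /andP[hs /eqP ghk].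
by case/negP: kP; rewrite -ghk; apply: allpairs_f.
Qed.

Definition gr_mul x y := GrRing (fin_supp_mul x y).

(* The homogeneous element of degree [g] given by the class of [a]; only
    meaningful for [nu a >= g]. *)
Definition gr_delta_fun g a (h : G) : gr_piece h :=
  if h == g then piece_class h a else 0.

Lemma fin_supp_delta g a : fin_supp (gr_delta_fun g a).
Proof.
exists [:: g] => h; rewrite inE /gr_delta_fun.
by case: eqP.
Qed.

Definition gr_delta g a := GrRing (fin_supp_delta g a).

Lemma gr_ind (P : gr_ring -> Prop) : P 0 ->
  (forall x y, P x -> P y -> P (x + y)) ->
  (forall g a, fin g <= nu a -> P (gr_delta g a)) -> forall x, P x.
Proof.
move=> P0 PD Pd x; case: (gr_suppE x) => r ur rP.
have -> : x = \sum_(g <- r) gr_delta g (piece_repr (x g)).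
  apply: gr_ext => h.
  have -> : (\sum_(g <- r) gr_delta g (piece_repr (x g))) h =
            \sum_(g <- r) gr_delta g (piece_repr (x g)) h.
    by elim/big_rec2: _ => // g y z _ <-.
  have [hr|hr] := boolP (h \in r).
    rewrite (bigD1_seq h) //= big1 ?addr0 => [|g gh].
      by rewrite /gr_delta_fun eqxx piece_reprK.
    by rewrite /gr_delta_fun eq_sym (negPf gh).
  rewrite rP // big_seq big1 // => g gr /=; rewrite /gr_delta_fun.
  by case: eqP gr hr => // <- ->.
elim/big_ind: _ => // g _; apply: Pd; exact: piece_reprP.
Qed.

Lemma gr_mul_delta g h a b : fin g <= nu a -> fin h <= nu b ->
  gr_mul (gr_delta g a) (gr_delta h b) = gr_delta (g + h) (a * b).
Proof.
move=> ga hb; apply: gr_ext => k /=.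
rewrite (@gr_mul_funE [:: g] [:: h]) //; first last.
- by move=> l; rewrite inE /= /gr_delta_fun => /negPf ->.
- by move=> l; rewrite inE /= /gr_delta_fun => /negPf ->.
rewrite big_seq1 big_mkcond big_seq1 /= /gr_delta_fun !eqxx eq_sym.
by case: eqP => // ->; rewrite piece_mul_class.
Qed.

Lemma gr_mulC : commutative gr_mul.
Proof.
move=> x y; apply: gr_ext => k /=.
have [[r ur rP] [s us sP]] := (gr_suppE x, gr_suppE y).
rewrite (gr_mul_funE _ ur us rP sP) (gr_mul_funE _ us ur sP rP).
under eq_bigr do rewrite big_mkcond.
under [RHS]eq_bigr do rewrite big_mkcond.
rewrite exchange_big; apply: eq_bigr => h _; apply: eq_bigr => g _.
by rewrite addrC piece_mulC.
Qed.

Lemma gr_mulDl : left_distributive gr_mul +%R.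
Proof.
move=> x x' y; apply: gr_ext => k; rewrite grDE /=.
have [[r _ rP] [r' _ rP']] := (gr_suppE x, gr_suppE x').
have [s us sP] := gr_suppE y; pose t := undup (r ++ r').
have tP z : (z = x \/ z = x' \/ z = x + x') -> forall g, g \notin t -> z g = 0.
  move=> zP g; rewrite mem_undup mem_cat => /norP[gr gr'].
  by case: zP => [|[]] ->; rewrite ?grDE ?rP ?rP' ?addr0.
have ut : uniq t by apply: undup_uniq.
rewrite !(gr_mul_funE k ut us (tP _ _) sP); do ?by [left|right;left|right;right].
rewrite -big_split; apply: eq_bigr => g _; rewrite -big_split.
by apply: eq_bigr => h /eqP <-; rewrite grDE piece_mulDl.
Qed.

Lemma gr_mulDr x y z : gr_mul x (y + z) = gr_mul x y + gr_mul x z.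
Proof. by rewrite gr_mulC gr_mulDl ![gr_mul _ x]gr_mulC. Qed.

Lemma gr_mul0l x : gr_mul 0 x = 0.
Proof. by apply: (addrI (gr_mul 0 x)); rewrite -gr_mulDl !addr0. Qed.

Lemma gr_mul0r x : gr_mul x 0 = 0.
Proof. by rewrite gr_mulC gr_mul0l. Qed.

Lemma gr_mulA : associative gr_mul.
Proof.
elim/gr_ind=> [|x x' Hx Hx'|g a ga] y z; first by rewrite !gr_mul0l.
  by rewrite !gr_mulDl Hx Hx'.
elim/gr_ind: y z => [|y y' Hy Hy'|h b hb] z.
- by rewrite gr_mul0r !gr_mul0l gr_mul0r.
- by rewrite gr_mulDr !gr_mulDl -Hy -Hy' gr_mulDr.
elim/gr_ind: z => [|z z' Hz Hz'|k c kc]; first by rewrite !gr_mul0r.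
  by rewrite !gr_mulDr Hz Hz'.
by rewrite !gr_mul_delta ?valM ?finD ?leD_infty // mulrA addrA.
Qed.

Definition initial_form a : gr_ring :=
  if nu a is Some g then gr_delta g a else 0.

Definition gr_one := initial_form 1.

Lemma gr_oneE : gr_one = gr_delta 0 1.
Proof. by rewrite /gr_one /initial_form val1. Qed.

Lemma gr_mul1 : left_id gr_one gr_mul.
Proof.
rewrite gr_oneE; elim/gr_ind=> [|x y Hx Hy|g a ga]; first exact: gr_mul0r.
  by rewrite gr_mulDr Hx Hy.
by rewrite gr_mul_delta ?val1 // mul1r add0r.
Qed.

Lemma gr_one_neq0 : gr_one != 0.
Proof.
apply/eqP => /(congr1 (fun x : gr_ring => x 0)).
rewrite gr_oneE gr0E /= /gr_delta_fun eqxx -(piece_class0 0).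
suff /piece_class_eq H : ~~ (fin 0 < nu (1 - 0)).
  by apply/H; rewrite ?val1 ?val0.
by rewrite subr0 val1 ltxx.
Qed.

HB.instance Definition _ := GRing.Zmodule_isComNzRing.Build gr_ring
  gr_mulA gr_mulC gr_mul1 gr_mulDl gr_one_neq0.

Definition gr_unit : pred gr_ring := fun x => `[< exists y, y * x = 1 >].

Definition gr_inv (x : gr_ring) : gr_ring :=
  if pselect (exists y, y * x = 1) is left e then projT1 (cid e) else x.

Lemma gr_mulVx : {in gr_unit, left_inverse 1 gr_inv *%R}.
Proof.
move=> x /asboolP ux; rewrite /gr_inv.
by case: pselect => // e; case: (cid e).
Qed.

Lemma gr_unitP (x y : gr_ring) : y * x = 1 -> gr_unit x.
Proof. by move=> yx; apply/asboolP; exists y. Qed.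

Lemma gr_inv_out : {in [predC gr_unit], gr_inv =1 id}.
Proof.
move=> x /negP nux; rewrite /gr_inv; case: pselect => // e.
by case: nux; apply/asboolP.
Qed.

HB.instance Definition _ := GRing.ComNzRing_hasMulInverse.Build gr_ring
  gr_mulVx gr_unitP gr_inv_out.

Definition homogeneous (x : gr_ring) : Prop :=
  exists g, forall h, h != g -> x h = 0.

End GradedRing.

Definition divides (A : comUnitRingType) (p q : A) : Prop :=
  exists c, q = p * c.

Definition irreducible (A : comUnitRingType) (p : A) : Prop :=
  [/\ p != 0, p \isn't a GRing.unit
    & forall a b, p = a * b -> a \is a GRing.unit \/ b \is a GRing.unit].

Section Extensions.
Variables (K : fieldType) (G : oGroupType) (nu0 : valuation K G).

Record extension := Extension {
  ext_val :> valuation {poly K} G;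
  ext_valP : forall c : K, ext_val c%:P = nu0 c
}.

(* [Base] stands for [nu0], whose domain is [K] rather than [K[x]]. *)
Inductive vspace := Base | Ext of extension.

Definition vle (v w : vspace) : Prop :=
  match v, w with
  | Base, _ => True
  | Ext _, Base => False
  | Ext nu, Ext mu => forall f : {poly K}, nu f <= mu f
  end.

Definition vlt (v w : vspace) : Prop := vle v w /\ v <> w.

Definition vmaximal (v : vspace) : Prop := forall w, vle v w -> w = v.

Lemma extension_ext (nu mu : extension) : (forall f, nu f = mu f) -> nu = mu.
Proof.
case: nu mu => [nu nuP] [mu muP] /= /valuation_ext E.
by rewrite -{}E in muP *; congr Extension; apply: Prop_irrelevance.
Qed.

Lemma vle_refl v : vle v v.
Proof. by case: v => //= nu f. Qed.

Lemma vle_trans v w z : vle v w -> vle w z -> vle v z.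
Proof.
by case: v w z => [|v] [|w] [|z] //= vw wz f; apply: le_trans (wz f).
Qed.

Lemma vle_anti v w : vle v w -> vle w v -> v = w.
Proof.
case: v w => [|v] [|w] //= vw wv; congr Ext; apply: extension_ext => f.
by apply/le_anti; rewrite vw wv.
Qed.

(* [Base] is excluded: its support is the zero ideal of [K], and [F] is
    nonzero in the intended use. *)
Definition VFinfty (F : {poly K}) (v : vspace) : Prop :=
  if v is Ext mu then forall f : {poly K}, in_supp mu f <-> F %| f else False.

Definition VF (F : {poly K}) (v : vspace) : Prop :=
  exists2 mu, VFinfty F mu & vle v mu.

End Extensions.

(* Main.v *)
From mathcomp Require Import all_boot all_order all_algebra all_field ring.
From mathcomp Require Import boolp classical_sets.
Require Import Defs.

(** Let [w > nu] and let [Q] be a polynomial of least degree with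
    [nu Q < w Q].  Division by [Q] shows that the initial form of every [f] with
    [nu f < w f] is a multiple of the non-unit [in Q].  Hence two non-associate
    irreducible homogeneous elements of the graded ring cannot both be raised by
    the same [w] ([increase_irreducible_divides]).  It is therefore enough to
    find, for each [i], a valuation [mu_i >= nu] with support [(F)] that raises a
    polynomial [q_i] whose initial form is [phi_i]; distinctness and strictness
    are then automatic.

    First assume that every finite value of [nu] lies in the divisible hull of
    the value group of [nu0].  Let [L = K[x]/(F)], let [A] be the image in [L] of
    [{nu >= 0}], and let [I] be the image of [{nu > 0}] plus that of the
    multiples of [q_i] of nonnegative value.  The ideal [I] of [A] is proper: a
    relation [1 = p + q_i b + F h] would give, in degree 0 of the graded ring, an
    expression of 1 as a multiple of [phi_i], because [phi_i] divides [in F].  By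
    Chevalley's extension theorem ([valuation_ring_dominating]) some valuation
    ring [O] of [L] contains [A] and has [I] in its maximal ideal.  It meets [K]
    in the valuation ring of [nu0], and [L] is algebraic over [K], so a power of
    each nonzero element of [L] is a unit of [O] times an element of [K]; since
    the group is divisible this turns [O] into a valuation extending [nu0]
    ([valuation_of_ring]).  If [N nu f = nu0 c], then [f ^ N / c] has value 0 for
    [nu], hence maps into [A]; this gives [nu f <= mu_i f], and for [f = q_i] it
    maps into [I], which gives the strict inequality ([torsion_extension]).

    Otherwise let [Q] be a polynomial of least degree whose value lies outside
    the divisible hull.  The terms of a [Q]-adic expansion have distinct values,
    so every initial form is a power of [in Q] times the initial form of a
    polynomial of smaller degree, which is a unit.  Then all irreducible
    homogeneous elements are associate, [n <= 1], and any valuation with support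
    [(F)] above [nu] will do. *)

Set Implicit Arguments.
Unset Strict Implicit.
Unset Printing Implicit Defensive.
Import Order.TTheory GRing.Theory.
Local Open Scope ring_scope.

(** * Valuation rings dominating an ideal *)

Section Chevalley.
Local Open Scope classical_set_scope.
Variable L : fieldType.
Implicit Types (A B I J O : set L) (x y z : L).

Definition subring B : Prop :=
  [/\ B 1, forall x y, B x -> B y -> B (x - y)
    & forall x y, B x -> B y -> B (x * y)].

Section Subring.
Variables (B : set L) (Bring : subring B).

Lemma subring1 : B 1. Proof. by case: Bring. Qed.
Lemma subringB x y : B x -> B y -> B (x - y). Proof. by case: Bring => _ + _; apply. Qed.
Lemma subringM x y : B x -> B y -> B (x * y). Proof. by case: Bring => _ _; apply. Qed.
Lemma subring0 : B 0. Proof. by rewrite -(subrr 1); apply: subringB subring1 subring1. Qed.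
Lemma subringN x : B x -> B (- x).
Proof. by rewrite -sub0r; apply: subringB subring0. Qed.
Lemma subringD x y : B x -> B y -> B (x + y).
Proof. by move=> Bx By; rewrite -[y]opprK; apply/subringB/subringN. Qed.
Lemma subringX x n : B x -> B (x ^+ n).
Proof.
move=> Bx; elim: n => [|n IHn]; first by rewrite expr0; apply: subring1.
by rewrite exprS; apply: subringM.
Qed.

End Subring.

Inductive ideal_span I B : set L :=
| ideal_span0 : ideal_span I B 0
| ideal_spanD x b y : I x -> B b -> ideal_span I B y -> ideal_span I B (x * b + y).

Lemma ideal_span_sub I B C x : B `<=` C -> ideal_span I B x -> ideal_span I C x.
Proof.
move=> BC; elim=> [|a b y Ia Bb _ IHy]; first exact: ideal_span0.
by apply: ideal_spanD => //; apply: BC.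
Qed.

Lemma ideal_span_gen I B x b : I x -> B b -> ideal_span I B (x * b).
Proof. by move=> Ix Bb; rewrite -[_ * b]addr0; apply: ideal_spanD => //; apply: ideal_span0. Qed.

Lemma ideal_span_add I B x y :
  ideal_span I B x -> ideal_span I B y -> ideal_span I B (x + y).
Proof.
move=> Jx Jy; elim: Jx => [|a b z Ia Bb _ IHz]; first by rewrite add0r.
by rewrite -addrA; apply: ideal_spanD.
Qed.

Lemma ideal_spanM I B x b :
  subring B -> ideal_span I B x -> B b -> ideal_span I B (x * b).
Proof.
move=> Bring Jx Bb; elim: Jx => [|a c y Ia Bc _ IHy].
  by rewrite mul0r; apply: ideal_span0.
by rewrite mulrDl -mulrA; apply: ideal_spanD => //; apply: subringM.
Qed.

Lemma ideal_span_opp I B x : subring B -> ideal_span I B x -> ideal_span I B (- x).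
Proof.
move=> Bring Jx; rewrite -mulrN1; apply: ideal_spanM => //.
exact: (subringN Bring (subring1 Bring)).
Qed.

Lemma ideal_span_subset I B x : subring B -> I `<=` B -> ideal_span I B x -> B x.
Proof.
move=> Bring IB; elim=> [|a b y Ia Bb _ IHy]; first exact: subring0.
by apply: subringD => //; apply: subringM => //; apply: IB.
Qed.

Definition adjoin B x : set L :=
  [set y | exists2 p : {poly L}, (forall i, B p`_i) & y = p.[x]].

Lemma adjoin_subring B x : subring B -> subring (adjoin B x).
Proof.
move=> Bring; split=> [|_ _ [p pB ->] [q qB ->]|_ _ [p pB ->] [q qB ->]].
- exists 1 => [i|]; last by rewrite hornerC.
  by rewrite coef1; case: (i == 0%N) => /=; [exact: subring1|exact: subring0].
- exists (p - q) => [i|]; last by rewrite !hornerE.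
  by rewrite coefB; apply: subringB.
- exists (p * q) => [i|]; last by rewrite hornerM.
  rewrite coefM; apply: (big_ind B) => [|a b|j _]; first exact: subring0.
      exact: (subringD Bring).
  exact: (subringM Bring).
Qed.

Lemma subset_adjoin B x : subring B -> B `<=` adjoin B x.
Proof.
move=> Bring y By; exists y%:P => [i|]; last by rewrite hornerC.
by rewrite coefC; case: (i == 0%N) => //=; exact: subring0.
Qed.

Lemma mem_adjoin B x : subring B -> adjoin B x x.
Proof.
move=> Bring; exists 'X => [i|]; last by rewrite hornerX.
by rewrite coefX; case: (i == 1%N) => /=; [exact: subring1|exact: subring0].
Qed.

Lemma ideal_span_adjoin I B x y : ideal_span I (adjoin B x) y ->
  exists2 p : {poly L}, (forall i, ideal_span I B p`_i) & y = p.[x].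
Proof.
elim=> [|a _ z Ia [p pB ->] _ [q qJ ->]].
  by exists 0 => [i|]; rewrite ?horner0 // coef0; apply: ideal_span0.
exists (a *: p + q) => [i|]; last by rewrite !hornerE.
by rewrite coefD coefZ; apply: ideal_spanD.
Qed.

(** Lowering the degree of one of two relations [1 = p.[x]] and [1 = q.[x^-1]]
    with coefficients in [J]: multiply the first by [1 - q`_0] and replace
    its leading power of [x] by means of the second. *)
Lemma one_eq_horner_inv J x (m n : nat) (p q : {poly L}) :
    (forall y z, J y -> J z -> J (y - z)) -> (forall y z, J y -> J z -> J (y * z)) ->
    ~ J 1 -> x != 0 ->
    (size p <= n.+1)%N -> (size q <= m.+1)%N ->
    (forall i, J p`_i) -> (forall i, J q`_i) ->
  p.[x] = 1 -> q.[x^-1] = 1 -> False.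
Proof.
move=> JB JM J1.
have J0 : forall y, J y -> J 0 by move=> y Jy; rewrite -(subrr y); apply: JB.
have JN y : J y -> J (- y) by move=> Jy; rewrite -sub0r; apply: JB => //; apply: J0 Jy.
have JD y z : J y -> J z -> J (y + z) by move=> Jy Jz; rewrite -[z]opprK; apply/JB/JN.
elim: {m n}(n + m)%N {-2}n {-2}m (leqnn (n + m)) x p q => [|d IHd] n m.
  rewrite leqn0 addn_eq0 => /andP[/eqP-> _] x p q _ /size1_polyC pE _ pJ _ px _.
  by apply: J1; rewrite -px pE hornerC.
wlog le_mn : n m / (m <= n)%N.
  move=> WH le_d x p q x0 sp sq pJ qJ px qx.
  have [le_mn|/ltnW le_nm] := leqP m n; first exact: (WH n m le_mn le_d x p q).
  apply: (WH m n le_nm _ x^-1 q p); rewrite ?invr_eq0 ?invrK //.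
  by rewrite addnC.
case: n le_mn => [|n] le_mn le_d x p q x0 sp sq pJ qJ px qx.
  apply: (IHd 0%N m _ x p q) => //.
  by move: le_mn; rewrite leqn0 => /eqP ->.
have sq' : (size q <= n.+2)%N by apply: leq_trans sq _.
(* With [a] the top coefficient of [p], this is
   [q`_0 + (1 - q`_0) (p - a X^n.+1) + a X^n.+1 (q(1/X) - q`_0)]. *)
pose p' := \poly_(i < n.+1)
  ((if i == 0%N then q`_0 else 0) + (p`_i - q`_0 * p`_i) + p`_n.+1 * q`_(n.+1 - i)).
apply: (IHd n m _ x p' q) => //.
- by rewrite size_poly.
- move=> i; rewrite coef_poly; case: ifP => _; last exact: J0 (pJ 0%N).
  apply: (JD _ _); last exact: JM.
  apply: (JD _ _); last by apply: JB => //; apply: JM.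
  by case: (i == 0%N) => //; apply: J0 (pJ 0%N).
have tail_q : \sum_(i < n.+1) q`_(n.+1 - i) * x ^+ i = x ^+ n.+1 * (1 - q`_0).
  have -> : 1 - q`_0 = \sum_(i < n.+1) q`_i.+1 * x^-1 ^+ i.+1.
    by rewrite -qx (horner_coef_wide _ sq') big_ord_recl expr0 mulr1 addrC addKr.
  rewrite mulr_sumr (reindex_inj rev_ord_inj); apply: eq_bigr => i _ /=.
  have le_in : (i <= n)%N by rewrite -ltnS.
  rewrite subSS subSn ?leq_subr // subKn // mulrCA; congr (_ * _).
  rewrite exprVn -[in x ^+ n.+1](subnK le_in) -addnS exprD.
  by rewrite mulfK ?expf_neq0.
have head_p : \sum_(i < n.+1) p`_i * x ^+ i = 1 - p`_n.+1 * x ^+ n.+1.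
  by rewrite -px (horner_coef_wide _ sp) [in RHS]big_ord_recr /= addrK.
rewrite horner_poly -[RHS](subrK q`_0) addrC.
under eq_bigr do rewrite !mulrDl mulNr -![_ * _ * x ^+ _]mulrA.
rewrite !big_split /= sumrN -!mulr_sumr head_p tail_q.
rewrite big_ord_recl expr0 mulr1 big1 => [|i _]; last by rewrite mul0r.
by ring.
Qed.

(** The extension step of Chevalley's theorem: the ideal generated by [I] stays
    proper in [B[x]] or in [B[1/x]]. *)
Lemma ideal_span_no_inv_pair I B x : subring B -> I `<=` B -> ~ ideal_span I B 1 ->
  x != 0 -> ideal_span I (adjoin B x) 1 -> ideal_span I (adjoin B x^-1) 1 -> False.
Proof.
move=> Bring IB J1 x0 /ideal_span_adjoin[p pJ p1] /ideal_span_adjoin[q qJ q1].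
apply: (@one_eq_horner_inv (ideal_span I B) x (size q) (size p) p q) => //.
  by move=> y z Jy Jz; apply/ideal_span_add/ideal_span_opp.
by move=> y z Jy /ideal_span_subset Bz; apply: ideal_spanM => //; apply: Bz.
Qed.

(** Chevalley's extension theorem.  Among the subrings over [A] in which [I] does
    not generate the unit ideal, a maximal one is a valuation ring, since it
    absorbs [x] or [x^-1] for every [x].  The last clause says that [I] lies in
    its maximal ideal. *)
Theorem valuation_ring_dominating A I :
    subring A -> I `<=` A -> ~ ideal_span I A 1 ->
  exists O : set L, [/\ subring O, A `<=` O, forall x, O x \/ O x^-1
    & forall x b, I x -> O b -> x * b != 1].
Proof.
move=> Aring IA I1.
(* The empty set is admitted only because the union of the empty chain is
   empty. *)
pose P B := B = set0 \/ [/\ subring B, A `<=` B & ~ ideal_span I B 1].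
have [F FP Ftot|O [OP Omax]] := @Zorn_bigcup L P.
  have [[B [FB B0]]|noB] := pselect (exists B, F B /\ B !=set0); last first.
    left; apply/seteqP; split=> // x [B FB Bx]; case: noB; exists B.
    by split=> //; exists x.
  have FPne C x : F C -> C x -> [/\ subring C, A `<=` C & ~ ideal_span I C 1].
    by move=> FC Cx; case: (FP C FC) => // C0; rewrite C0 in Cx.
  have [b Bb] := B0; have [Bring AB _] := FPne B b FB Bb.
  have common x y : (\bigcup_(X in F) X) x -> (\bigcup_(X in F) X) y ->
      exists C, [/\ F C, C x & C y].
    move=> [C FC Cx] [D FD Dy].
    by case: (Ftot C D FC FD) => CD; [exists D|exists C]; split=> //; apply: CD.
  right; split.
  - split=> [|x y xF yF|x y xF yF]; first by exists B => //; apply: subring1.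
      have [C [FC Cx Cy]] := common x y xF yF.
      by have [Cring _ _] := FPne C x FC Cx; exists C => //; apply: subringB.
    have [C [FC Cx Cy]] := common x y xF yF.
    by have [Cring _ _] := FPne C x FC Cx; exists C => //; apply: subringM.
  - by move=> x /AB Bx; exists B.
  - move=> J1.
    have [C [FC [c Cc] JC1]] : exists C, [/\ F C, C !=set0 & ideal_span I C 1].
      elim: J1 => [|x c y Ix [C FC Cc] _ [D [FD D0 JDy]]].
        by exists B; split=> //; apply: ideal_span0.
      case: (Ftot C D FC FD) => CD; [exists D|exists C]; split=> //.
        - by apply: ideal_spanD => //; apply: CD.
        - by exists c.
      by apply: ideal_spanD => //; apply: ideal_span_sub JDy.
    by have [_ _ []] := FPne C c FC Cc.
have [Oring AO O1] : [/\ subring O, A `<=` O & ~ ideal_span I O 1].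
  case: OP => // O0; exfalso; apply: (Omax A); last by right; split.
  by rewrite O0; split=> // /(_ 1 (subring1 Aring)).
have IO : I `<=` O by move=> x /IA /AO.
have adjO x : ~ O x -> ideal_span I (adjoin O x) 1.
  move=> Ox; apply: contrapT => J1; apply: (Omax (adjoin O x)).
    split; first exact: subset_adjoin.
    by move=> /(_ x (mem_adjoin x Oring)).
  right; split=> //; first exact: adjoin_subring.
  by move=> y /AO Oy; apply: subset_adjoin.
exists O; split=> // [x|x b Ix Ob]; last first.
  by apply/eqP => xb1; apply: O1; rewrite -xb1; apply: ideal_span_gen.
have [->|x0] := eqVneq x 0; first by left; apply: subring0.
apply: contrapT => /not_orP[/adjO Ox /adjO Ox'].
exact: (ideal_span_no_inv_pair Oring IO O1 x0).
Qed.

End Chevalley.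

(** * From a valuation ring to a valuation with values in a divisible group *)

Section OrderedGroup.
Variable G : oGroupType.
Implicit Types (g h : G) (x y : with_infty G).

Lemma ogroup_subr_ge0 g h : (0 <= h - g) = (g <= h).
Proof.
apply/idP/idP => [/(ogroup_leD2l g)|/(ogroup_leD2l (- g))].
  by rewrite addr0 addrC subrK.
by rewrite addNr addrC.
Qed.

Lemma fin_mulrn g N : fin g *+ N = fin (g *+ N).
Proof. by elim: N => // N IHN; rewrite !mulrS IHN. Qed.

(** Comparison of multiples is what makes division by [N] in the value group
    order preserving, hence unique. *)
Lemma ler_mulrn_infty N x y : (0 < N)%N -> (x *+ N <= y *+ N) = (x <= y).
Proof.
case: N => // N _; apply/idP/idP; last first.
  by move=> xy; elim: N => // N IHN; rewrite mulrS [y *+ _]mulrS leD_infty.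
apply: contraLR; rewrite -!ltNge; case: y => [g gx|]; last by rewrite ltNge lex_infty.
rewrite -[Some g]/(fin g) in gx *; rewrite fin_mulrn; elim: N => [|N IHN]; first by rewrite mulr1n.
by rewrite mulrS [x *+ _]mulrS ltD_infty // ltW.
Qed.

Lemma infty_or_fin x : x = infty \/ exists g, x = fin g.
Proof. by case: x => [g|]; [right; exists g|left]. Qed.

Lemma addr_infty x : x + infty = infty.
Proof. by case: x. Qed.

Lemma leD2r_infty g x y : (x + fin g <= y + fin g) = (x <= y).
Proof.
apply/idP/idP => [/leD_infty/(_ (lexx (fin (- g))))|xy]; last exact: leD_infty.
by rewrite -!addrA -!finD addrN !addr0.
Qed.

Lemma add_infty_eq0 x y : x + y = 0 -> exists g, x = fin g /\ y = fin (- g).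
Proof.
case: x y => [g|] [h|] //= [] /eqP; rewrite addrC addr_eq0 => /eqP ->.
by exists g.
Qed.

End OrderedGroup.

Section ValuationTheory.
Variables (R : comNzRingType) (G : oGroupType) (nu : valuation R G).

Lemma valX a n : nu (a ^+ n) = nu a *+ n.
Proof.
elim: n => [|n IHn]; first by rewrite expr0 val1 mulr0n.
by rewrite exprS valM IHn mulrS.
Qed.

Lemma valM_ge0 a b : fin 0 <= nu a -> fin 0 <= nu b -> fin 0 <= nu (a * b).
Proof. by rewrite valM => a0 b0; rewrite -(addr0 (0 : G)) finD leD_infty. Qed.

Lemma valM_gt0 a b : fin 0 < nu a -> fin 0 <= nu b -> fin 0 < nu (a * b).
Proof. by rewrite valM => a0 b0; rewrite -(addr0 (0 : G)) ltD_infty. Qed.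

Lemma valB_lt a b : nu a < nu (a - b) -> nu b = nu a.
Proof.
move=> ab; apply/le_anti/andP; split.
  rewrite leNgt; apply/negP => ba.
  by have := valDgt ab ba; rewrite subrK ltxx.
rewrite -[b](subKr a) -[a - _ in leRHS]addrC valDge ?valN //.
exact: ltW.
Qed.

End ValuationTheory.

Lemma val_field (K : fieldType) (G : oGroupType) (nu : valuation K G) c :
  c != 0 -> exists g, nu c = fin g /\ nu c^-1 = fin (- g).
Proof. by move=> c0; apply: add_infty_eq0; rewrite -valM mulfV // val1. Qed.

Section ValuationOfRing.
Local Open Scope classical_set_scope.
Variables (K L : fieldType) (G : oGroupType) (iota : {rmorphism K -> L}).
Variables (nu0 : valuation K G) (O : set L).
Hypotheses (Oring : subring O) (Oval : forall x, O x \/ O x^-1).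
Hypothesis OK : forall c, O (iota c) <-> fin 0 <= nu0 c.

Definition ring_unit x := [/\ x != 0, O x & O x^-1].

Lemma ring_unitM x y : ring_unit x -> ring_unit y -> ring_unit (x * y).
Proof.
move=> [x0 Ox Ox'] [y0 Oy Oy']; split; first exact: mulf_neq0.
  exact: subringM.
by rewrite invfM; apply: subringM.
Qed.

Lemma ring_unitV x : ring_unit x -> ring_unit x^-1.
Proof. by case=> x0 Ox Ox'; split; rewrite ?invr_eq0 ?invrK. Qed.

Lemma ring_unitX x n : ring_unit x -> ring_unit (x ^+ n).
Proof. by case=> x0 Ox Ox'; split; rewrite ?expf_neq0 -?exprVn //; apply: subringX. Qed.

Lemma ring_unit1 : ring_unit 1.
Proof. by split; rewrite ?oner_neq0 ?invr1 //; apply: subring1. Qed.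

(** A valuation ring is local: if [x] is in [O] but is not a unit, then [1 + x]
    is a unit. *)
Lemma ring_unit_1D x : O x -> ~ O x^-1 -> ring_unit (1 + x).
Proof.
move=> Ox Ox'; have O1 := subring1 Oring.
have x0 : x != 0 by apply: contra_notN Ox' => /eqP ->; rewrite invr0; apply: subring0.
have y0 : 1 + x != 0.
  apply: contra_notN Ox'; rewrite addrC addr_eq0 => /eqP ->.
  by rewrite invrN invr1; apply: subringN.
split=> //; first exact: subringD.
have [Oyx|] := Oval ((1 + x)^-1 * x).
  have -> : (1 + x)^-1 = 1 - (1 + x)^-1 * x by field.
  exact: subringB.
rewrite invfM invrK => Oyx; case: Ox'.
have -> : x^-1 = (1 + x) * x^-1 - 1 by field.
exact: subringB.
Qed.

Lemma mem_ring_exp x n : (0 < n)%N -> O (x ^+ n) -> O x.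
Proof.
case: n => // n _ Oxn; have [//|Ox'] := Oval x.
have [->|x0] := eqVneq x 0; first exact: subring0.
have -> : x = x ^+ n.+1 * x^-1 ^+ n by rewrite exprSr exprVn mulrAC mulfV ?mul1r ?expf_neq0.
by apply: subringM => //; apply: subringX.
Qed.

(** The only possible value [g] of [z] for a valuation with ring [O] that extends
    [nu0]: if [z ^ N] is [c] up to a unit of [O], then [N g = nu0 c]. *)
Definition root_value z g :=
  exists N c, [/\ (0 < N)%N, c != 0, ring_unit (z ^+ N / iota c) & fin g *+ N = nu0 c].

Lemma root_value_neq0 z g : root_value z g -> z != 0.
Proof.
move=> [N [c [N0 c0 [+ _ _] _]]]; apply: contraNneq => ->.
by rewrite expr0n -[N == 0%N]negbK -lt0n N0 mul0r.
Qed.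

Lemma root_valueM z w g h : root_value z g -> root_value w h -> root_value (z * w) (g + h).
Proof.
move=> [N [c [N0 c0 Uz gc]]] [M [d [M0 d0 Uw hd]]].
exists (N * M)%N, (c ^+ M * d ^+ N); split.
- by rewrite muln_gt0 N0.
- by rewrite mulf_neq0 ?expf_neq0.
- have -> : (z * w) ^+ (N * M) / iota (c ^+ M * d ^+ N) =
      (z ^+ N / iota c) ^+ M * (w ^+ M / iota d) ^+ N.
    by rewrite rmorphM !rmorphXn invfM !exprMn !exprVn -!exprM [(M * N)%N]mulnC mulrACA.
  by apply: ring_unitM; apply: ring_unitX.
- by rewrite valM !valX -gc -hd -!mulrnA [(M * N)%N]mulnC finD mulrnDl.
Qed.

Lemma root_valueV z g : root_value z g -> root_value z^-1 (- g).
Proof.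
move=> [N [c [N0 c0 Uz gc]]]; exists N, c^-1; split=> //; first by rewrite invr_eq0.
  by rewrite fmorphV exprVn -invfM; apply: ring_unitV.
have [k [ck ->]] := val_field nu0 c0.
by move: gc; rewrite ck !fin_mulrn mulNrn => -[->].
Qed.

Lemma root_value_ge0 z g : root_value z g -> O z <-> 0 <= g.
Proof.
move=> [N [c [N0 c0 [u0 Ou Ou'] gc]]].
have ic0 : iota c != 0 by rewrite fmorph_eq0.
rewrite -fin_le -(ler_mulrn_infty _ _ N0) gc mul0rn -OK; split=> Oz.
  have -> : iota c = z ^+ N * (z ^+ N / iota c)^-1.
    have zN0 : z ^+ N != 0 by apply: contraNneq u0 => ->; rewrite mul0r.
    by rewrite invf_div mulrCA mulfV ?mulr1.
  by apply: subringM => //; apply: subringX.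
by apply: (mem_ring_exp N0); rewrite -(divfK ic0 (z ^+ N)); apply: subringM.
Qed.

(** Values of the unit 1 are nonnegative, and [g - h], [h - g] are both values
    of 1. *)
Lemma root_value_uniq z g h : root_value z g -> root_value z h -> g = h.
Proof.
suff le g' h' : root_value z g' -> root_value z h' -> g' <= h'.
  by move=> zg zh; apply/le_anti; rewrite !le.
move=> zg zh; rewrite -ogroup_subr_ge0.
have /root_value_ge0 <- := root_valueM zh (root_valueV zg).
by rewrite mulfV ?(root_value_neq0 zg) //; apply: subring1.
Qed.

(** If no power of [z] is an element of [K] up to a unit of [O], then the
    monomials in [z] over [K] have pairwise distinct values, so that the value
    of a polynomial expression in [z] is that of one of its monomials. *)
Lemma horner_assoc_monomial z (p : {poly K}) : z != 0 -> p != 0 ->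
    (forall N c, (0 < N)%N -> c != 0 -> ~ ring_unit (z ^+ N / iota c)) ->
  exists k c, c != 0 /\ ring_unit ((map_poly iota p).[z] / (iota c * z ^+ k)).
Proof.
move=> z0 + noroot; elim/poly_ind: p => [|p c IHp]; first by rewrite eqxx.
rewrite rmorphD rmorphM /= map_polyX map_polyC !hornerE /=.
have [-> pc0|p0 _] := eqVneq p 0.
  have c0 : c != 0 by apply: contraNneq pc0 => ->; rewrite mul0r addr0.
  exists 0%N, c; split=> //; rewrite rmorph0 horner0 mul0r add0r mulr1 mulfV ?fmorph_eq0 //.
  exact: ring_unit1.
have [k [d [d0 [u0 Ou Ou']]]] := IHp p0.
have id0 : iota d != 0 by rewrite fmorph_eq0.
set q := (map_poly iota p).[z] in u0 Ou Ou' *.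
have q0 : q != 0 by apply: contraNneq u0 => ->; rewrite mul0r.
have Ut : ring_unit (q * z / (iota d * z ^+ k.+1)).
  suff -> : q * z / (iota d * z ^+ k.+1) = q / (iota d * z ^+ k) by [].
  by rewrite exprSr mulrA -mulf_div mulfV // mulr1.
have [->|c0] := eqVneq c 0; first by exists k.+1, d; rewrite rmorph0 addr0.
have ic0 : iota c != 0 by rewrite fmorph_eq0.
have nU : ~ ring_unit (q * z / iota c).
  move=> /(ring_unitM (ring_unitV Ut)).
  have -> : (q * z / (iota d * z ^+ k.+1))^-1 * (q * z / iota c) = z ^+ k.+1 / iota (c / d).
    by rewrite fmorph_div; field; rewrite id0 ic0 z0 q0 expf_neq0.
  by apply: noroot; rewrite // mulf_neq0 ?invr_eq0.
have qzc0 : q * z / iota c != 0 by rewrite !mulf_neq0 ?invr_eq0.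
have [Oqc|Oqc] := Oval (q * z / iota c).
  exists 0%N, c; split=> //; rewrite mulr1 mulrDl mulfV // addrC.
  by apply: ring_unit_1D => // Oqc'; apply: nU.
exists k.+1, d; split=> //.
have -> : (q * z + iota c) / (iota d * z ^+ k.+1) =
    (q * z / (iota d * z ^+ k.+1)) * (1 + (q * z / iota c)^-1).
  by field; rewrite id0 ic0 z0 q0 expf_neq0.
by apply: ring_unitM => //; apply: ring_unit_1D; rewrite ?invrK // => Oqc'; apply: nU.
Qed.

Hypothesis L_alg : integralRange iota.
Hypothesis Gdiv : divisible_group G.

(** A monic relation satisfied by [z] over [K] rules out the alternative in
    [horner_assoc_monomial], as a unit is nonzero. *)
Lemma root_value_exists z : z != 0 -> exists g, root_value z g.
Proof.
move=> z0; have [[N [c [N0 c0 U]]]|noroot] :=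
  pselect (exists N c, [/\ (0 < N)%N, c != 0 & ring_unit (z ^+ N / iota c)]).
  have [k [ck _]] := val_field nu0 c0; have [g gk] := Gdiv k N0.
  by exists g, N, c; rewrite fin_mulrn gk.
have [p p_monic /rootP pz] := L_alg z.
have [|k [c [c0 [/negP[]]]]] := horner_assoc_monomial z0 (monic_neq0 p_monic).
  by move=> N c N0 c0 U; apply: noroot; exists N, c.
by rewrite pz mul0r.
Qed.

Definition ring_val z : with_infty G :=
  if pselect (exists g, root_value z g) is left zP then fin (projT1 (cid zP)) else infty.

Lemma ring_valE z g : root_value z g -> ring_val z = fin g.
Proof.
rewrite /ring_val; case: pselect => [zP zg|nz zg]; last by case: nz; exists g.
by case: (cid zP) => h zh /=; rewrite (root_value_uniq zg zh).
Qed.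

Lemma ring_val0 : ring_val 0 = infty.
Proof.
rewrite /ring_val; case: pselect => // zP.
by have [g /root_value_neq0] := zP; rewrite eqxx.
Qed.

Lemma ring_val1 : ring_val 1 = 0.
Proof.
apply: ring_valE; exists 1%N, 1; rewrite expr1 rmorph1 divr1 oner_neq0 val1 mul0rn.
by split=> //; apply: ring_unit1.
Qed.

Lemma ring_valM a b : ring_val (a * b) = ring_val a + ring_val b.
Proof.
have [->|/root_value_exists[g ag]] := eqVneq a 0; first by rewrite mul0r ring_val0.
have [->|/root_value_exists[h bh]] := eqVneq b 0.
  by rewrite mulr0 ring_val0 addr_infty.
by rewrite (ring_valE ag) (ring_valE bh) (ring_valE (root_valueM ag bh)).
Qed.

Lemma ring_valD a b : Order.min (ring_val a) (ring_val b) <= ring_val (a + b).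
Proof.
wlog ab : a b / ring_val a <= ring_val b.
  move=> WH; have /orP[ab|ba] := le_total (ring_val a) (ring_val b); first exact: WH.
  by rewrite minC addrC; apply: WH.
rewrite (min_idPl ab).
have [a0|a0] := eqVneq a 0.
  by move: ab; rewrite a0 add0r.
have [->|b0] := eqVneq b 0; first by rewrite addr0.
have [->|ab0] := eqVneq (a + b) 0; first by rewrite ring_val0 lex_infty.
have [[g ag] [h bh] [k abk]] :=
  And3 (root_value_exists a0) (root_value_exists b0) (root_value_exists ab0).
move: ab; rewrite (ring_valE ag) (ring_valE bh) (ring_valE abk) !fin_le.
rewrite -ogroup_subr_ge0 -[g <= k]ogroup_subr_ge0.
have /root_value_ge0 <- := root_valueM bh (root_valueV ag).
have /root_value_ge0 <- := root_valueM abk (root_valueV ag).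
by move=> Oba; rewrite mulrDl mulfV //; apply: subringD => //; apply: subring1.
Qed.

(** Since [L] is algebraic over [K], the value group of [O] is torsion over that
    of [nu0], and so it embeds over it in the divisible group [G] in a unique way. *)
Theorem valuation_of_ring : exists v : valuation L G,
  (forall c, v (iota c) = nu0 c) /\ (forall z, O z <-> fin 0 <= v z).
Proof.
exists (Valuation ring_valM ring_valD ring_val1 ring_val0); split=> [c|z] /=.
  have [->|c0] := eqVneq c 0; first by rewrite rmorph0 ring_val0 val0.
  have [g [cg _]] := val_field nu0 c0; rewrite cg; apply: ring_valE; exists 1%N, c.
  by rewrite expr1 mulfV ?fmorph_eq0 //; split=> //; apply: ring_unit1.
have [->|/root_value_exists[g zg]] := eqVneq z 0.
  by rewrite ring_val0 lex_infty; split=> // _; apply: subring0.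
by rewrite (ring_valE zg) fin_le; apply: root_value_ge0.
Qed.

End ValuationOfRing.

(** * Graded rings and initial forms *)

Section Divides.
Variable A : comUnitRingType.
Implicit Types p q x y : A.

Lemma divides_add p x y : divides p x -> divides p y -> divides p (x + y).
Proof. by case=> c -> [d ->]; exists (c + d); rewrite mulrDr. Qed.

Lemma divides1_unit p : divides p 1 -> p \is a GRing.unit.
Proof. by case=> c pc; apply/unitrPr; exists c. Qed.

Lemma irreducible_divides_of_common_divisor p1 p2 q : irreducible p1 ->
  q \isn't a GRing.unit -> divides q p1 -> divides q p2 -> divides p1 p2.
Proof.
move=> [_ _ irr1] nuq [c qc] [d ->].
have [uq|uc] := irr1 _ _ qc; first by rewrite uq in nuq.
by exists (c^-1 * d); rewrite qc mulrA mulrK.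
Qed.

End Divides.

Section GradedRing.
Variables (R : comNzRingType) (G : oGroupType) (nu : valuation R G).
Implicit Types (a b c : R) (g h : G).

Lemma initial_formE a g : nu a = fin g -> initial_form nu a = gr_delta nu g a.
Proof. by rewrite /initial_form => ->. Qed.

Lemma gr_delta_eq g a b : fin g <= nu a -> fin g < nu (a - b) ->
  gr_delta nu g a = gr_delta nu g b.
Proof.
move=> ga gab; have gb : fin g <= nu b.
  by rewrite -(subKr a b) valDge ?valN // ltW.
apply: gr_ext => h; rewrite /= /gr_delta_fun; case: eqP => // ->.
exact/piece_class_eq.
Qed.

Lemma gr_deltaM g h a b : fin g <= nu a -> fin h <= nu b ->
  gr_delta nu g a * gr_delta nu h b = gr_delta nu (g + h) (a * b).
Proof. exact: gr_mul_delta. Qed.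

Lemma gr_delta_add g a b : fin g <= nu a -> fin g <= nu b ->
  gr_delta nu g (a + b) = gr_delta nu g a + gr_delta nu g b.
Proof.
move=> ga gb; apply: gr_ext => h; rewrite grDE /= /gr_delta_fun.
by case: eqP => [->|_]; rewrite ?piece_classD ?addr0.
Qed.

Lemma gr_delta_eq0 g a : fin g < nu a -> gr_delta nu g a = 0.
Proof.
move=> ga; rewrite (@gr_delta_eq g a 0) ?subr0 ?ltW //.
apply: gr_ext => h; rewrite /= /gr_delta_fun; case: eqP => // ->.
exact: piece_class0.
Qed.

Lemma initial_form_eq a b : nu a < nu (a - b) -> initial_form nu a = initial_form nu b.
Proof.
move=> ab; have ba := valB_lt ab.
have [a_inf|[g ag]] := infty_or_fin (nu a); first by move: ab; rewrite a_inf ltNge lex_infty.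
by rewrite !(@initial_formE _ g) ?ba // (@gr_delta_eq g a b) -?ag.
Qed.

Lemma initial_formM a b : initial_form nu (a * b) = initial_form nu a * initial_form nu b.
Proof.
have [a_inf|[g ag]] := infty_or_fin (nu a).
  by rewrite /initial_form valM a_inf mul0r.
have [b_inf|[h bh]] := infty_or_fin (nu b).
  by rewrite /initial_form valM b_inf addr_infty mulr0.
rewrite (initial_formE ag) (initial_formE bh) (@initial_formE _ (g + h)).
  by rewrite gr_deltaM ?ag ?bh.
by rewrite valM ag bh.
Qed.

Lemma initial_form1 : initial_form nu 1 = 1.
Proof. by []. Qed.

Lemma initial_formX a n : initial_form nu (a ^+ n) = initial_form nu a ^+ n.
Proof. by elim: n => [|n IHn]; rewrite ?expr0 // !exprS initial_formM IHn. Qed.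

(** Multiplicativity of initial forms in degree 0 without assuming that the
    value of [a * b] is exactly 0: when it is positive, or [a] is in the support,
    the right-hand side vanishes. *)
Lemma divides_gr_delta0 a b : fin 0 <= nu (a * b) ->
  divides (initial_form nu a) (gr_delta nu 0 (a * b)).
Proof.
rewrite valM; have [a_inf _|[g ag]] := infty_or_fin (nu a).
  by exists 0; rewrite mulr0 gr_delta_eq0 // valM a_inf.
rewrite ag => /(leD_infty (lexx (fin (- g)))).
rewrite addr0 addrA -finD addNr add0r => gb.
exists (gr_delta nu (- g) b); rewrite (initial_formE ag).
by rewrite gr_deltaM ?ag // subrr.
Qed.

Lemma homogeneous_initial_form x : homogeneous x -> x != 0 ->
  exists2 a, nu a <> infty & x = initial_form nu a.
Proof.
move=> [g gP] x0; pose a := piece_repr (x g).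
have xE : x = gr_delta nu g a.
  apply: gr_ext => h; rewrite /= /gr_delta_fun; case: eqP => [->|/eqP/gP //].
  by rewrite piece_reprK.
have ag : nu a = fin g.
  apply/eqP; rewrite eq_sym eq_le piece_reprP leNgt; apply: contraNN x0 => ga.
  by rewrite xE gr_delta_eq0.
by exists a; rewrite ?ag // (initial_formE ag).
Qed.

(** The degree 0 part of a multiple of [in a] is the class of a multiple of [a],
    so an inverse of [in a] can be handled without first showing that it is
    homogeneous. *)
Lemma gr_mul_initial_form_coord0 (y : gr_ring nu) a : exists2 c, fin 0 <= nu (c * a) &
  (y * initial_form nu a) 0 = piece_class nu 0 (c * a).
Proof.
have zero : exists2 c, fin 0 <= nu (c * a) & 0 = piece_class nu 0 (c * a).
  by exists 0; rewrite ?mul0r ?piece_class0 // val0 lex_infty.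
have [a_inf|[g ag]] := infty_or_fin (nu a).
  by rewrite [initial_form nu a]/initial_form a_inf mulr0.
rewrite (initial_formE ag); elim/gr_ind: y => [|x y [c c0 xc] [d d0 yd]|h b hb].
- by rewrite mul0r.
- exists (c + d); first by rewrite mulrDl valDge.
  by rewrite mulrDl grDE xc yd mulrDl piece_classD.
- rewrite gr_deltaM ?ag //.
  have [hg|hg] := eqVneq 0 (h + g); last first.
    by rewrite /= /gr_delta_fun (negPf hg).
  exists b; last by rewrite /= /gr_delta_fun -hg eqxx.
  by rewrite valM ag hg finD leD_infty.
Qed.

(** Turns invertibility in the graded ring into a statement about [nu] alone. *)
Lemma initial_form_unitP a :
  initial_form nu a \is a GRing.unit <-> exists c, fin 0 < nu (1 - c * a).
Proof.
split=> [/unitrPr[y]|[c ca]]; last first.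
  apply: divides1_unit; exists (initial_form nu c).
  by rewrite -initial_formM mulrC -initial_form1; apply: initial_form_eq; rewrite val1.
rewrite mulrC => y1; have [c c0] := gr_mul_initial_form_coord0 y a.
rewrite y1 => c1; exists c; apply/piece_class_eq => //; first by rewrite val1.
rewrite -c1 -[RHS]/(gr_one nu 0) gr_oneE /= /gr_delta_fun.
by rewrite eqxx.
Qed.

End GradedRing.

(** * Comparing two valuations, and values outside the divisible hull *)

Lemma min_size_poly (K : fieldType) (P : {poly K} -> Prop) f : P f ->
  exists2 Q, P Q & forall g, P g -> (size Q <= size g)%N.
Proof.
move=> Pf; have exP : exists n, `[< exists2 g, P g & size g = n >].
  by exists (size f); apply/asboolP; exists f.
case: (ex_minnP exP) => n /asboolP[Q PQ Qn] nmin; exists Q => // g Pg.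
by rewrite Qn; apply: nmin; apply/asboolP; exists g.
Qed.

Section MinimalIncrease.
Variables (K : fieldType) (G : oGroupType) (nu w : valuation {poly K} G).
Hypothesis nu_le : forall f, nu f <= w f.

Lemma val_mul_lt f Q : nu Q < w Q -> nu (f * Q) <> infty -> nu (f * Q) < w (f * Q).
Proof.
rewrite !valM => lt_Q.
have [->//|[g fg]] := infty_or_fin (nu f).
have [->|[h Qh]] := infty_or_fin (nu Q); first by rewrite addr_infty.
rewrite fg Qh in lt_Q * => _.
rewrite addrC [w f + _]addrC -finD; apply: ltD_infty => //.
by rewrite -fg.
Qed.

(** If [c * Q] were 1 up to larger value, then [w] would give [c * Q] a positive
    value, and so also 1. *)
Lemma increase_initial_form_nonunit Q :
  nu Q < w Q -> initial_form nu Q \isn't a GRing.unit.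
Proof.
move=> lt_Q; apply/negP => /initial_form_unitP[c c0].
have cQ0 : nu (c * Q) = 0 by rewrite -(val1 nu); apply: valB_lt; rewrite val1.
have lt_cQ : nu (c * Q) < w (c * Q) by apply: val_mul_lt; rewrite // cQ0.
have : fin 0 < w (1 - c * Q + c * Q).
  by apply: valDgt; [apply: lt_le_trans (nu_le _)|rewrite -[fin 0]/(0 : with_infty G) -cQ0].
by rewrite subrK val1 ltxx.
Qed.

(** For [Q] of least degree, [nu] and [w] agree on the remainder [r] of [f] modulo
    [Q], whereas [w] raises [f] and multiples of [Q].  So [r] cannot contribute
    to the initial form of [f]. *)
Lemma increase_initial_form_generator f : nu f < w f ->
  exists2 Q, nu Q < w Q &
    forall g, nu g < w g -> divides (initial_form nu Q) (initial_form nu g).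
Proof.
case/(@min_size_poly _ (fun g => nu g < w g)) => Q lt_Q Qmin; exists Q => // {}f lt_f.
have Q0 : Q != 0 by apply: contraTneq lt_Q => ->; rewrite !val0 ltxx.
have fE := divp_eq f Q.
set q := f %/ Q in fE; set r := f %% Q in fE.
have rE : nu r = w r.
  apply/eqP; rewrite eq_le nu_le leNgt; apply/negP => /Qmin.
  by rewrite leqNgt ltn_modp Q0.
have lt_fr : nu f < nu r.
  rewrite ltNge; apply/negP => le_rf.
  have le_rq : nu r <= nu (q * Q).
    have -> : q * Q = f - r by rewrite fE addrK.
    by rewrite valDge ?valN.
  have wq : w (q * Q) = w r.
    rewrite -[q * Q]opprK valN; apply: valB_lt.
    by rewrite opprK addrC -fE -rE (le_lt_trans le_rf).
  have qE : nu (q * Q) = nu r by apply/le_anti; rewrite le_rq rE -wq nu_le.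
  have : nu (q * Q) < w (q * Q).
    apply: val_mul_lt => //; rewrite qE => r_inf.
    by have := le_lt_trans le_rf lt_f; rewrite r_inf ltNge lex_infty.
  by rewrite wq qE rE ltxx.
exists (initial_form nu q); rewrite mulrC -initial_formM; apply: initial_form_eq.
by rewrite {2}fE addrC addKr.
Qed.

(** This gives the distinctness of the valuations attached to distinct factors. *)
Lemma increase_irreducible_divides f g :
    irreducible (initial_form nu f) -> nu f < w f -> nu g < w g ->
  divides (initial_form nu f) (initial_form nu g).
Proof.
move=> irr_f lt_f lt_g; have [Q lt_Q Qgen] := increase_initial_form_generator lt_f.
apply: (irreducible_divides_of_common_divisor irr_f).
- exact: increase_initial_form_nonunit lt_Q.
- exact: Qgen.
- exact: Qgen.
Qed.

End MinimalIncrease.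

Section Torsion.
Variables (K : fieldType) (G : oGroupType) (nu0 : valuation K G).
Implicit Types (x y : with_infty G).

(** [x] is finite and lies in the divisible hull of the value group of [nu0]. *)
Definition torsion x :=
  exists N c, [/\ (0 < N)%N, c != 0 & x *+ N = nu0 c].

Lemma torsion_val c : c != 0 -> torsion (nu0 c).
Proof. by exists 1%N, c. Qed.

Lemma torsion_fin x : torsion x -> exists g, x = fin g.
Proof.
move=> [N [c [N0 c0]]]; have [g [-> _]] := val_field nu0 c0.
have [->|//] := infty_or_fin x.
by case: N N0 => // N _; rewrite mulrS.
Qed.

Lemma torsionD x y : torsion x -> torsion y -> torsion (x + y).
Proof.
move=> [N [c [N0 c0 xc]]] [M [d [M0 d0 yd]]].
exists (N * M)%N, (c ^+ M * d ^+ N); rewrite muln_gt0 N0 mulf_neq0 ?expf_neq0 //.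
split=> //; rewrite mulrnDl mulrnA xc mulnC mulrnA yd.
by rewrite valM !valX.
Qed.

Lemma torsion_opp g : torsion (fin g) -> torsion (fin (- g)).
Proof.
move=> [N [c [N0 c0 gc]]]; exists N, c^-1; rewrite invr_eq0; split=> //.
have [h [ch ->]] := val_field nu0 c0.
by move: gc; rewrite ch !fin_mulrn mulNrn => -[->].
Qed.

Lemma torsion_cancel x y : torsion x -> torsion (x + y) -> torsion y.
Proof.
move=> tx txy; have [g xg] := torsion_fin tx; rewrite {}xg in tx txy.
have := torsionD (torsion_opp tx) txy.
by rewrite addrA -finD addNr add0r.
Qed.

Lemma torsion_mulrn x n : (0 < n)%N -> torsion (x *+ n) -> torsion x.
Proof.
move=> n0 [N [c [N0 c0 xc]]]; exists (n * N)%N, c.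
by rewrite muln_gt0 n0 mulrnA.
Qed.

End Torsion.

Section NonTorsion.
Variables (K : fieldType) (G : oGroupType) (nu0 : valuation K G) (nu : extension nu0).
Hypothesis nu_fin : forall f : {poly K}, f != 0 -> nu f <> infty.
Variable Q : {poly K}.
Hypothesis Q0 : Q != 0.
Hypothesis Q_nontorsion : ~ torsion nu0 (nu Q).
Hypothesis Q_min : forall f : {poly K}, f != 0 ->
  (size f < size Q)%N -> torsion nu0 (nu f).

(** Induction on the degree of [a].  In [Q = k * a + r] the values of [k * a] and
    [r] are torsion and that of [Q] is not, so [in (k * a) = - in r], which is a
    unit by induction. *)
Lemma nontorsion_low_size_unit (a : {poly K}) : a != 0 -> (size a < size Q)%N ->
  initial_form nu a \is a GRing.unit.
Proof.
elim: {a}(size a) {-2}a (leqnn (size a)) => [|n IHn] a.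
  by rewrite leqn0 size_poly_eq0 => ->.
move=> size_a a0 a_lt.
have [a1|a1] := leqP (size a) 1.
  have aE := size1_polyC a1.
  have c0 : a`_0 != 0 by apply: contraNneq a0 => c0; rewrite aE c0.
  apply/initial_form_unitP; exists (a`_0)^-1%:P.
  by rewrite {2}aE -polyCM mulVf // subrr val0.
have QE := divp_eq Q a.
set k := Q %/ a in QE; set r := Q %% a in QE.
have k0 : k != 0 by rewrite divp_eq0 (negPf Q0) (negPf a0) -leqNgt ltnW.
have k_lt : (size k < size Q)%N.
  by rewrite size_divp // ltn_subrL size_poly_gt0 Q0 andbT -subn1 subn_gt0.
have t_ka : torsion nu0 (nu (k * a)) by rewrite valM; apply: torsionD; apply: Q_min.
have r0 : r != 0.
  by apply: contra_notN Q_nontorsion => /eqP r0; rewrite QE r0 addr0.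
have r_lt : (size r < size a)%N by rewrite ltn_modp.
have t_r : torsion nu0 (nu r) by apply: Q_min => //; apply: ltn_trans a_lt.
have kaE : k * a = Q - r by rewrite QE addrK.
have lt_rQ : nu (k * a) < nu Q.
  rewrite lt_neqAle; apply/andP; split.
    by apply: contra_notN Q_nontorsion => /eqP <-.
  rewrite leNgt; apply/negP => Q_lt; apply: Q_nontorsion.
  by rewrite -(@valB_lt _ _ nu Q r) // -kaE.
have /initial_form_eq kar : nu (k * a) < nu (k * a - (- r)) by rewrite opprK -QE.
have := IHn (- r); rewrite oppr_eq0 size_polyN -kar initial_formM unitrM.
case/(_ _ r0 _)/andP => //; first by rewrite -ltnS (leq_trans r_lt).
exact: ltn_trans a_lt.
Qed.

(** The [Q]-adic terms of [f] have values in distinct cosets of the torsion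
    values, so exactly one of them has least value. *)
Lemma nontorsion_Q_adic_initial_form (f : {poly K}) : f != 0 ->
  exists (a : {poly K}) k, [/\ a != 0, (size a < size Q)%N & nu f < nu (f - a * Q ^+ k)].
Proof.
have fin_lt_infty x : x <> infty -> x < (infty : with_infty G).
  by case: x.
elim: {f}(size f) {-2}f (leqnn (size f)) => [|n IHn] f.
  by rewrite leqn0 size_poly_eq0 => ->.
move=> size_f f0.
have [f_lt|f_ge] := ltnP (size f) (size Q).
  exists f, 0%N; split=> //; rewrite expr0 mulr1 subrr val0.
  exact/fin_lt_infty/nu_fin.
have Q1 : (1 < size Q)%N.
  rewrite ltnNge; apply: contra_notN Q_nontorsion => Q1; rewrite (size1_polyC Q1) ext_valP.
  by apply: torsion_val; apply: contraNneq Q0 => c0; rewrite (size1_polyC Q1) c0.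
have fE := divp_eq f Q.
set q := f %/ Q in fE; set r := f %% Q in fE.
have q0 : q != 0 by rewrite divp_eq0 (negPf f0) (negPf Q0) -leqNgt.
have size_q : (size q <= n)%N.
  rewrite -ltnS (leq_trans _ size_f) // size_divp // ltn_subrL size_poly_gt0 f0.
  by rewrite andbT -subn1 subn_gt0.
have [a [k [a0 a_lt q_lt]]] := IHn q size_q q0.
have qQ : nu (q * Q) < nu (q * Q - a * Q ^+ k.+1).
  rewrite exprSr mulrA -mulrBl !valM.
  have [Q_inf|[h Qh]] := infty_or_fin (nu Q); first by case: (nu_fin Q0).
  have [q_inf|[g qg]] := infty_or_fin (nu q); first by case: (nu_fin q0).
  by rewrite Qh qg -finD; apply: ltD_infty; rewrite // -qg.
have nt_qQ : ~ torsion nu0 (nu (q * Q)).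
  rewrite -(valB_lt qQ) valM valX => t.
  apply: Q_nontorsion; apply: (@torsion_mulrn _ _ _ _ k.+1) => //.
  by apply: torsion_cancel t; apply: Q_min.
have [r0|r0] := eqVneq r 0.
  by exists a, k.+1; split=> //; rewrite fE r0 addr0.
have t_r : torsion nu0 (nu r) by apply: Q_min; rewrite ?ltn_modp.
have [lt_qr|lt_rq|E] := ltgtP (nu (q * Q)) (nu r).
- have -> : nu f = nu (q * Q).
    by apply: valB_lt; rewrite fE opprD addNKr valN.
  exists a, k.+1; split=> //; rewrite fE addrAC.
  by apply: valDgt.
- exists r, 0%N; split; rewrite ?ltn_modp // expr0 mulr1.
  suff <- : nu r = nu f by rewrite fE addrK.
  by symmetry; apply: valB_lt; rewrite fE opprD addrCA subrr addr0 valN.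
- by rewrite E in nt_qQ.
Qed.

Lemma nontorsion_irreducible_divides x y :
    homogeneous x -> homogeneous y -> irreducible x -> irreducible y ->
  divides x (y : gr_ring nu).
Proof.
have dvdQ z : homogeneous z -> irreducible z ->
    exists u k, [/\ u \is a GRing.unit, (0 < k)%N & z = u * initial_form nu Q ^+ k].
  move=> z_homog [z0 nu_z _]; have [f f_fin zE] := homogeneous_initial_form z_homog z0.
  have f0 : f != 0 by apply: contra_not_neq f_fin => ->; rewrite val0.
  have [a [k [a0 a_lt f_lt]]] := nontorsion_Q_adic_initial_form f0.
  have ua := nontorsion_low_size_unit a0 a_lt.
  move: zE; rewrite (initial_form_eq f_lt) initial_formM initial_formX => zE.
  exists (initial_form nu a), k; split=> //.
  by case: k f_lt zE => [|k] // _ zE; move: nu_z; rewrite zE expr0 mulr1 ua.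
have dvdQ' z : homogeneous z -> irreducible z -> divides (initial_form nu Q) z.
  move=> z_homog z_irr; have [u [k [_ + ->]]] := dvdQ z z_homog z_irr; case: k => // k _.
  by exists (u * initial_form nu Q ^+ k); rewrite exprS mulrCA.
move=> xh yh x_irr y_irr.
apply: (irreducible_divides_of_common_divisor x_irr _ (dvdQ' x _ _) (dvdQ' y _ _)) => //.
have [u [k [uu _ xE]]] := dvdQ x xh x_irr.
case: x_irr => _ nux _; apply: contraNN nux => uQ.
by rewrite xE unitrM uu unitrX.
Qed.

End NonTorsion.

(** * Extending to the residue field of F *)

Section IrreduciblePoly.
Variables (K : fieldType) (F : {poly K}).
Hypothesis F_irr : irreducible_poly F.

Lemma irreducible_poly_bezout f : ~~ (F %| f) -> exists u v, u * F + v * f = 1.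
Proof.
move=> Ff; have /Bezout_eq1_coprimepP[[u v] uv1] : coprimep F f.
  rewrite /coprimep; apply/negPn/negP => d1.
  have /andP[_ Fd] := F_irr.2 _ d1 (dvdp_gcdl F f).
  by rewrite (dvdp_trans Fd (dvdp_gcdr F f)) in Ff.
by exists u, v.
Qed.

Lemma irreducible_poly_residue_field : F \is monic ->
  exists (L : fieldType) (iota : {rmorphism K -> L}) (ev : {rmorphism {poly K} -> L}),
    [/\ forall c, ev c%:P = iota c, forall f, ev f = 0 <-> F %| f & integralRange iota].
Proof.
move=> F_monic; have [L _ [z Fz Lz]] := irredp_FAdjoin F_irr.
exists L, (in_alg L), (horner_alg z); split=> [c|f|y].
- exact: horner_algC.
- have evF : horner_alg z F = 0 by apply/eqP.
  split=> [evf|/dvdpP[q ->]]; last by rewrite rmorphM /= evF mulr0.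
  apply/negPn/negP => /irreducible_poly_bezout[u [v /(congr1 (horner_alg z))]].
  rewrite rmorphD !rmorphM /= evF evf !mulr0 addr0 rmorph1.
  by move/eqP; rewrite eq_sym oner_eq0.
- have /Fadjoin1_polyP[p ->] : y \in <<1; z>>%VS by rewrite Lz memvf.
  apply: integral_horner; last by exists F.
  by apply/integral_poly => i; rewrite coef_map; apply: integral_id.
Qed.

Variables (G : oGroupType) (nu0 : valuation K G) (nu : extension nu0).

(** Otherwise the support of [nu] is [(F)], and [nu] is a valuation of the field
    [K[x]/(F)]; comparable valuations of a field, with the same group, are equal,
    so [nu] would be maximal. *)
Lemma support_trivial : VF F (Ext nu) -> ~ vmaximal (Ext nu) ->
  forall f : {poly K}, f != 0 -> nu f <> infty.
Proof.
move=> [[//|w] /= wF nu_w] nu_nmax f f0 f_inf; apply: nu_nmax => -[//|w'] nu_w'.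
have supp_F (g : {poly K}) : nu g = infty -> F %| g.
  by move=> g_inf; apply/wF/le_anti; rewrite lex_infty -g_inf nu_w.
(* Strip factors [F] from an element of the support of [nu], which is contained
   in that of [w]. *)
have F_inf : nu F = infty.
  elim: {f}(size f) {-2}f (leqnn (size f)) f0 f_inf => [|n IHn] f.
    by rewrite leqn0 size_poly_eq0 => ->.
  move=> size_f f0 f_inf; have /dvdpP[q fE] := supp_F f f_inf.
  have [q0 F0] : q != 0 /\ F != 0 by apply/andP; rewrite -negb_or -mulf_eq0 -fE.
  have [q_inf|[g qg]] := infty_or_fin (nu q).
    apply: (IHn q) => //; rewrite -ltnS; apply: leq_trans size_f.
    rewrite fE size_mul // -subn1 -addnBA ?size_poly_gt0 //.
    by rewrite -[ltnLHS]addn0 ltn_add2l subn_gt0; case: F_irr.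
  by move: f_inf; rewrite fE valM qg; case: (nu F).
congr Ext; apply: extension_ext => g; apply/esym/eqP; rewrite eq_le nu_w' /=.
have F_inf' : w' F = infty by apply/le_anti; rewrite lex_infty -F_inf nu_w'.
have [/dvdpP[q ->]|/irreducible_poly_bezout[u [v uv]]] := boolP (F %| g).
  by rewrite !valM F_inf addr_infty lex_infty.
have val_vg (m : valuation {poly K} G) : m F = infty -> m v + m g = 0.
  move=> mF; rewrite -valM -(val1 m); apply: valB_lt.
  by rewrite val1 -uv addrK valM mF addr_infty.
(* Modulo [F], [v] is inverse to [g]; so [w' v >= nu v] bounds [w' g] from
   above. *)
have [a [va ga]] := add_infty_eq0 (val_vg nu F_inf).
have [b [vb gb]] := add_infty_eq0 (val_vg w' F_inf').
have := nu_w' v; rewrite ga gb va vb !fin_le => /(ogroup_leD2l (- a - b)).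
by rewrite addrAC addNr add0r addrNK.
Qed.

End IrreduciblePoly.

Definition val_comp (R S : comNzRingType) (G : oGroupType) (f : {rmorphism R -> S})
    (v : valuation S G) : valuation R G.
Proof.
exists (v \o f) => [a b|a b||] /=.
- by rewrite rmorphM valM.
- by rewrite rmorphD valD.
- by rewrite rmorph1 val1.
- by rewrite rmorph0 val0.
Defined.

Section TorsionScale.
Variables (K : fieldType) (G : oGroupType) (nu0 : valuation K G) (m : valuation {poly K} G).
Variables (f : {poly K}) (x : with_infty G) (N : nat) (c : K).
Hypotheses (N_gt0 : (0 < N)%N) (c0 : c != 0) (xc : x *+ N = nu0 c).
Hypothesis m_ext : forall a : K, m a%:P = nu0 a.

(** When [x = nu0 c / N], the value of [f ^ N / c] compares with 0 as that of [f]
    does with [x]. *)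
Lemma torsion_scale_ge : (fin 0 <= m (f ^+ N * c^-1%:P)) = (x <= m f).
Proof.
have [g [cg cg']] := val_field nu0 c0.
by rewrite valM valX m_ext cg' -(addrN g) finD leD2r_infty -cg -xc ler_mulrn_infty.
Qed.

Lemma torsion_scale_le : (m (f ^+ N * c^-1%:P) <= fin 0) = (m f <= x).
Proof.
have [g [cg cg']] := val_field nu0 c0.
by rewrite valM valX m_ext cg' -(addrN g) finD leD2r_infty -cg -xc ler_mulrn_infty.
Qed.

End TorsionScale.

Section TorsionExtension.
Local Open Scope classical_set_scope.
Variables (K : fieldType) (G : oGroupType) (nu0 : valuation K G) (nu : extension nu0).
Hypothesis Gdiv : divisible_group G.
Variables (F : {poly K}) (F_monic : F \is monic) (F_irr : irreducible_poly F).
Hypothesis nu_torsion : forall f : {poly K}, f != 0 -> torsion nu0 (nu f).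

(** Lifting [nu] to a valuation with support [(F)] in a direction prescribed by an
    irreducible factor of [in F], by Chevalley's theorem. *)
Theorem torsion_extension (q : {poly K}) : q != 0 ->
    irreducible (initial_form nu q) -> divides (initial_form nu q) (initial_form nu F) ->
  exists mu : extension nu0,
    [/\ VFinfty F (Ext mu), vle (Ext nu) (Ext mu) & nu q < mu q].
Proof.
move=> q0 q_irr q_dvd.
have [L [iota [ev [ev_iota ev0 L_alg]]]] := irreducible_poly_residue_field F_irr F_monic.
pose A : set L := [set y | exists2 f, fin 0 <= nu f & y = ev f].
pose I : set L := [set y | exists p b,
  [/\ fin 0 < nu p, fin 0 <= nu (q * b) & y = ev (p + q * b)]].
have Aring : subring A.
  split=> [|_ _ [f f0 ->] [g g0 ->]|_ _ [f f0 ->] [g g0 ->]].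
  - by exists 1; rewrite ?val1 ?rmorph1.
  - by exists (f - g); rewrite ?rmorphB // valDge ?valN.
  - by exists (f * g); rewrite ?rmorphM // valM_ge0.
have IA : I `<=` A.
  by move=> _ [p [b [p0 b0 ->]]]; exists (p + q * b) => //; rewrite valDge // ltW.
have spanI y : ideal_span I A y -> I y.
  elim=> [|_ _ {}y [p [b [p0 b0 ->]]] [f f0 ->] _ [p' [b' [p'0 b'0 ->]]]].
    by exists 0, 0; rewrite mulr0 addr0 rmorph0 val0 lex_infty.
  exists (p * f + p'), (b * f + b'); split.
  - by rewrite valDgt // valM_gt0.
  - by rewrite mulrDr mulrA valDge // valM_ge0.
  - by rewrite -rmorphM -rmorphD; congr (ev _); ring.
(* Take the degree 0 part of [1 = p + q b + F h] in the graded ring. *)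
have I1 : ~ ideal_span I A 1.
  move=> /spanI[p [b [p0 b0 /eqP]]]; rewrite -(rmorph1 ev) -subr_eq0 -rmorphB.
  move=> /eqP/ev0/dvdpP[h]; rewrite [h * F]mulrC => /eqP; rewrite subr_eq => /eqP E1.
  have Fh0 : fin 0 <= nu (F * h).
    rewrite -[F * h](addrK (p + q * b)) -E1 valDge ?val1 // valN valDge //.
    exact: ltW.
  case: q_irr => _ /negP nuq _; apply: nuq; apply: divides1_unit.
  rewrite -[1]/(gr_one nu) gr_oneE E1 gr_delta_add //; last by rewrite valDge // ltW.
  rewrite gr_delta_add ?(ltW p0) // (gr_delta_eq0 p0) add0r.
  apply: divides_add; last exact: divides_gr_delta0.
  have [c FE] := q_dvd; have [d ->] := divides_gr_delta0 Fh0.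
  by exists (c * d); rewrite FE mulrA.
have [O [Oring AO Oval Omax]] := valuation_ring_dominating Aring IA I1.
(* An element of [K] of negative value has its inverse in [I], so it is not
   in [O]. *)
have OK c : O (iota c) <-> fin 0 <= nu0 c.
  split=> [Oc|c0]; last by apply: AO; exists c%:P; rewrite ?ext_valP ?ev_iota.
  rewrite leNgt; apply/negP => c_lt.
  have c0 : c != 0 by apply: contraTneq c_lt => ->; rewrite val0 ltNge lex_infty.
  have [g [cg cg']] := val_field nu0 c0.
  suff /Omax/(_ Oc) : I (iota c^-1) by rewrite -rmorphM mulVf // rmorph1 eqxx.
  exists c^-1%:P, 0; rewrite mulr0 addr0 val0 lex_infty ev_iota ext_valP; split=> //.
  rewrite cg' fin_lt lt_def -[0 <= _]ogroup_subr_ge0 subr0.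
  move: c_lt; rewrite cg fin_lt lt_neqAle oppr_eq0 => /andP[-> /=].
  by rewrite -ogroup_subr_ge0 sub0r.
have [v [v_iota v_ge0]] := valuation_of_ring Oring Oval OK L_alg Gdiv.
have mu_ext c : val_comp ev v c%:P = nu0 c by rewrite /= ev_iota v_iota.
exists (Extension mu_ext); split=> [f|f|] /=.
- rewrite /in_supp /= -ev0; split=> [v_inf|->]; last exact: val0.
  apply/eqP/negP => /negP evf0.
  by have [g []] := val_field v evf0; rewrite v_inf.
- have [->|f0] := eqVneq f 0; first by rewrite rmorph0 !val0.
  have [N [c [N0 c0 fc]]] := nu_torsion f0.
  rewrite -(torsion_scale_ge f N0 c0 fc mu_ext) -v_ge0; apply: AO.
  exists (f ^+ N * c^-1%:P) => //.
  by rewrite (torsion_scale_ge f N0 c0 fc (@ext_valP _ _ _ nu)).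
- have [N [c [N0 c0 qc]]] := nu_torsion q0.
  rewrite ltNge -(torsion_scale_le q N0 c0 qc mu_ext); apply/negP => y_le0.
  set y := ev (q ^+ N * c^-1%:P).
  have Iy : I y.
    exists 0, (q ^+ N.-1 * c^-1%:P); rewrite val0 add0r mulrA -exprS prednK //; split=> //.
    by rewrite (torsion_scale_ge q N0 c0 qc (@ext_valP _ _ _ nu)).
  have y0 : y != 0.
    by apply: contraTneq y_le0 => y0; rewrite /= -/y y0 val0.
  have [g [yg yg']] := val_field v y0.
  suff Oy' : O y^-1 by have /eqP[] := Omax _ _ Iy Oy'; rewrite mulfV.
  apply/v_ge0; rewrite yg' fin_le -[- g]sub0r ogroup_subr_ge0.
  by move: y_le0; rewrite /= -/y yg fin_le.
Qed.

End TorsionExtension.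

(** * Valuations attached to the irreducible factors *)

Theorem theorem1p3 (K : fieldType) (G : oGroupType) (Gdiv : divisible_group G)
    (nu0 : valuation K G)
    (F : {poly K}) (F_monic : F \is monic) (F_irr : irreducible_poly F)
    (nu : extension nu0) (nu_VF : VF F (Ext nu)) (nu_nmax : ~ vmaximal (Ext nu))
    (n : nat) (u : gr_ring nu) (phi : 'I_n -> gr_ring nu) (r : 'I_n -> nat)
    (u_unit : u \is a GRing.unit)
    (r_gt0 : forall i, (0 < r i)%N)
    (phi_homog : forall i, homogeneous (phi i))
    (phi_irr : forall i, irreducible (phi i))
    (phi_ndvd : forall i j, i != j -> ~ divides (phi i) (phi j))
    (inF : initial_form nu F = u * \prod_(i < n) phi i ^+ r i) :
  exists mu : 'I_n -> vspace nu0,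
    injective mu /\ (forall i, VFinfty F (mu i) /\ vlt (Ext nu) (mu i)).
Proof.
have nu_fin := support_trivial F_irr nu_VF nu_nmax.
have phi_inj i j : divides (phi i) (phi j) -> i = j.
  by move=> dvd_ij; apply/eqP/negPn/negP => /phi_ndvd.
have [tors|] := pselect (forall f : {poly K}, f != 0 -> torsion nu0 (nu f)); last first.
  move=> /existsNP[f] /not_implyP[f0 nt_f].
  have [|Q [Q0 nt_Q] Qmin] :=
    @min_size_poly K (fun f => f != 0 /\ ~ torsion nu0 (nu f)) f => //.
  have Q_min (g : {poly K}) : g != 0 -> (size g < size Q)%N -> torsion nu0 (nu g).
    move=> g0; rewrite ltnNge => /negP ltQ; apply: contrapT => nt_g.
    by apply: ltQ; apply: Qmin; split.
  (* All factors are associate, so the index set has at most one element. *)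
  case: nu_VF => w wF nu_w; exists (fun=> w); split=> [i j _|i].
    apply: phi_inj; exact: (nontorsion_irreducible_divides nu_fin Q0 nt_Q Q_min).
  split=> //; split=> // nuE; case: (nu_fin F (monic_neq0 F_monic)).
  by move: wF; rewrite -nuE => /(_ F)[_]; apply.
have lift_phi i : exists q : {poly K}, q != 0 /\ phi i = initial_form nu q.
  have [phi0 _ _] := phi_irr i.
  have [q q_fin ->] := homogeneous_initial_form (phi_homog i) phi0; exists q; split=> //.
  by apply: contra_not_neq q_fin => ->; rewrite val0.
have mu_i i : exists mu : extension nu0, [/\ VFinfty F (Ext mu), vle (Ext nu) (Ext mu) &
    exists q : {poly K}, phi i = initial_form nu q /\ nu q < mu q].
  have [q [q0 phiE]] := lift_phi i.
  have q_irr : irreducible (initial_form nu q) by rewrite -phiE.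
  have q_dvd : divides (initial_form nu q) (initial_form nu F).
    rewrite inF -phiE (bigD1 i) //= -(prednK (r_gt0 i)) exprS.
    exists (u * (phi i ^+ (r i).-1 * \prod_(j < n | j != i) phi j ^+ r j)).
    by rewrite -mulrA [RHS]mulrCA.
  have [mu [muF nu_mu lt_q]] := torsion_extension Gdiv F_monic F_irr tors q0 q_irr q_dvd.
  by exists mu; split=> //; exists q.
have [mu muP] := choice mu_i.
exists (fun i => Ext (mu i)); split=> [i j [mu_ij]|i]; last first.
  have [muF nu_mu [q [_ lt_q]]] := muP i; split=> //; split=> // -[nuE].
  by rewrite -nuE ltxx in lt_q.
have [_ nu_mu [q [phi_i lt_q]]] := muP i; have [_ _ [p [phi_j lt_p]]] := muP j.
apply: phi_inj; rewrite phi_i phi_j.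
rewrite -mu_ij in lt_p; apply: (increase_irreducible_divides nu_mu) lt_q lt_p.
by rewrite -phi_i; apply: phi_irr.
Qed.
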